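(* Let $G$ be a finite group generated by pseudoreflections on $\mathbb{C}^n$, let $\Omega\subseteq\mathbb{C}^n$ be a bounded $G$-invariant domain, let $\{\theta_i\}_{i=1}^n$ be a homogeneous system of parameters associated to $G$, and let $\mathcal{H}\subseteq\mathcal{O}(\Omega)$ be an analytic Hilbert module with a $G$-invariant reproducing kernel. Then for every $\varrho\in\widehat G$ and every $i$ with $1\le i\le\deg\varrho$, $\mathbb{P}_\varrho^{ii}\mathcal{H}$ is a reducing submodule of the Hilbert module $\mathcal{H}$ over the ring $\mathbb{C}[\boldsymbol z]^G$ of $G$-invariant polynomials (that is, a joint reducing subspace for the operator tuple $\mathbf{M}_{\boldsymbol\theta}=(M_{\theta_1},\ldots,M_{\theta_n})$). Consequently, the number of reducing submodules of $\mathcal H$ over $\mathbb{C}[\boldsymbol z]^G$ is at least $\sum_{\varrho\in\widehat G}\deg\varrho$.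
   Context: A pseudoreflection on $\mathbb{C}^n$ is a linear map $\rho$ of finite order in $GL(n,\mathbb{C})$ such that $I_n-\rho$ has rank $1$. $\Omega$ is $G$-invariant if $\sigma(\Omega)=\Omega$ for all $\sigma\in G$. A homogeneous system of parameters (hsop) associated to $G$ is a family $\{\theta_i\}_{i=1}^n$ of algebraically independent homogeneous $G$-invariant polynomials with $\mathbb{C}[\boldsymbol z]^G=\mathbb{C}[\theta_1,\ldots,\theta_n]$, where $\mathbb{C}[\boldsymbol z]^G$ is the ring of $G$-invariant polynomials in $\mathbb{C}[\boldsymbol z]=\mathbb{C}[z_1,\ldots,z_n]$. An analytic Hilbert module $\mathcal{H}\subseteq\mathcal{O}(\Omega)$ (over $\mathbb{C}[\boldsymbol z]$) is a Hilbert space of holomorphic functions on $\Omega$ with a reproducing kernel $K:\Omega\times\Omega\to\mathbb{C}$, on which multiplication by each polynomial is a bounded operator, and which contains $\mathbb{C}[\boldsymbol z]$ as a dense subspace. $K$ is $G$-invariant if $K(\sigma\boldsymbol z,\sigma\boldsymbol w)=K(\boldsymbol z,\boldsymbol w)$ for all $\sigma\in G$, $\boldsymbol z,\boldsymbol w\in\Omega$. $\mathcal{H}$ is viewed as a Hilbert module over $\mathbb{C}[\boldsymbol z]^G$ by pointwise multiplication. $M_{\theta_i}$ is multiplication by $\theta_i$ on $\mathcal H$. A reducing submodule over $\mathbb{C}[\boldsymbol z]^G$ is a closed subspace invariant under multiplication by every $p\in\mathbb{C}[\boldsymbol z]^G$ and under the adjoints of these operators; a joint reducing subspace of a tuple is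 a closed subspace invariant under all the operators of the tuple and their adjoints. $\widehat G$ is the set of equivalence classes of irreducible (complex, finite-dimensional) representations of $G$, $\deg\varrho$ is the dimension of $\varrho$. For each $\varrho\in\widehat G$ fix a unitary matrix representation $\boldsymbol\pi_\varrho(\sigma)=(\boldsymbol\pi_\varrho^{ij}(\sigma))_{i,j=1}^{\deg\varrho}$ in the class $\varrho$. For $f\in\mathcal{H}$, $$\mathbb{P}_\varrho^{ij}f=\frac{\deg\varrho}{|G|}\sum_{\sigma\in G}\boldsymbol\pi_\varrho^{ji}(\sigma^{-1})\,(f\circ\sigma^{-1}),\qquad 1\le i,j\le\deg\varrho.$$ The operators $\mathbb{P}_\varrho^{ii}$ are orthogonal projections on $\mathcal H$. *)

(* Defs.v *)
(* The notations of multinomials clash with those of MathComp-Analysis and are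
   not imported: {mpoly C[n]} is written (mpoly n C), p.@[v] is (meval v p),
   p \mPo t is (comp_mpoly t p), d.-homog is (ishomog1 d mdeg). *)
From HB Require Import structures.
From mathcomp Require Import all_boot all_order all_algebra all_fingroup.
From mathcomp Require Import all_character.
From mathcomp Require Import all_classical all_reals all_analysis.
From mathcomp Require Import complex.
From mathcomp Require Import -(notations) mpoly.

Set Implicit Arguments.
Unset Strict Implicit.
Unset Printing Implicit Defensive.

Import Order.TTheory GRing.Theory Num.Theory numFieldNormedType.Exports.

Local Open Scope classical_set_scope.
Local Open Scope ring_scope.

(* The topology of MathComp-Analysis is attached to numClosedFieldType and is
   not found on the bare type R[i]. *)
Definition Cplx (R : realType) : numClosedFieldType := complex R.

Notation Cn R n := 'cV[Cplx R]_n.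

(* A function on Omega is represented by its extension by 0 to C^n (see
   [holo]), so that Leibniz equality is equality on Omega. *)
Notation Fn R n := (Cn R n -> (Cplx R)^o).

Definition ext0 (R : realType) (n : nat) (Omega : set (Cn R n)) (f : Fn R n) :
  Fn R n := patch (fun=> 0) Omega f.

Definition is_domain (R : realType) (n : nat) (Omega : set (Cn R n)) : Prop :=
  [/\ Omega !=set0, open Omega & connected Omega].

(* The scalar field is C, so [differentiable] is complex differentiability. *)
Definition holo (R : realType) (n : nat) (Omega : set (Cn R n)) :
    set (Fn R n) :=
  [set f | (forall z, Omega z -> differentiable f z) /\
           (forall z, ~ Omega z -> f z = 0)].

Definition peval (R : realType) (n : nat) (p : mpoly n (Cplx R)) : Fn R n :=
  fun z => meval (fun i => z i 0) p.

Definition mulop (R : realType) (n : nat) (p : mpoly n (Cplx R)) (f : Fn R n) :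
  Fn R n := fun z => peval p z * f z.

Section HilbertSpacesOfFunctions.
Context {R : realType} {n : nat}.
Implicit Types (H M : set (Fn R n)) (f g h : Fn R n).
Implicit Types (dot : Fn R n -> Fn R n -> Cplx R).

Definition hnorm dot f : R := Num.sqrt (complex.Re (dot f f)).

(* Only the values of [dot] on H matter. *)
Record hilbert_space H dot : Prop := HilbertSpace {
  hs_submod : submod_closed [in H];
  hs_linear : forall (a : Cplx R) f g h, H f -> H g -> H h ->
    dot (a *: f + g) h = a * dot f h + dot g h;
  hs_conj : forall f g, H f -> H g -> dot g f = (dot f g)^*;
  hs_pos : forall f, H f -> f != 0 -> 0 < dot f f;
  hs_complete : forall u : nat -> Fn R n, (forall k, H (u k)) ->
    (forall e : R, 0 < e -> exists N : nat, forall j k : nat,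
       (N <= j)%N -> (N <= k)%N -> hnorm dot (u j - u k) < e) ->
    exists2 f, H f & hnorm dot (u k - f) @[k --> \oo] --> (0 : R) }.

Definition reproducing_kernel (Omega : set (Cn R n)) H dot
    (K : Cn R n -> Cn R n -> Cplx R) : Prop :=
  forall w, Omega w ->
    H (ext0 Omega (K^~ w)) /\
    forall f, H f -> dot f (ext0 Omega (K^~ w)) = f w.

Record analytic_hilbert_module (Omega : set (Cn R n)) H dot
    (K : Cn R n -> Cn R n -> Cplx R) : Prop := AnalyticHilbertModule {
  ahm_hilbert : hilbert_space H dot;
  ahm_holo : H `<=` holo Omega;
  ahm_kernel : reproducing_kernel Omega H dot K;
  ahm_mul : forall (p : mpoly n (Cplx R)) f, H f -> H (mulop p f);
  ahm_bounded : forall p : mpoly n (Cplx R), exists c : R,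
    forall f, H f -> hnorm dot (mulop p f) <= c * hnorm dot f;
  ahm_poly : forall p : mpoly n (Cplx R), H (ext0 Omega (peval p));
  ahm_dense : forall f, H f -> forall e : R, 0 < e ->
    exists p : mpoly n (Cplx R), hnorm dot (f - ext0 Omega (peval p)) < e }.

Definition closed_subspace H dot M : Prop :=
  [/\ M `<=` H, submod_closed [in M] &
      forall (u : nat -> Fn R n) f, (forall k, M (u k)) -> H f ->
        hnorm dot (u k - f) @[k --> \oo] --> (0 : R) -> M f].

(* The g in H with <T h, f> = <h, g> for all h in H.  It is unique, and exists
   by the Riesz representation theorem when T is bounded on H. *)
Definition adjoint H dot (T : Fn R n -> Fn R n) f : Fn R n :=
  xget 0 [set g | H g /\ forall h, H h -> dot (T h) f = dot h g].

Definition joint_reducing H dot (ops : set (Fn R n -> Fn R n)) M : Prop :=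
  closed_subspace H dot M /\
  forall T, ops T -> forall f, M f -> M (T f) /\ M (adjoint H dot T f).

End HilbertSpacesOfFunctions.

Definition pseudoreflection (R : realType) (n : nat) (A : 'M[Cplx R]_n) :
    Prop :=
  [/\ A \in unitmx, exists2 k : nat, (0 < k)%N & A ^+ k = 1
    & \rank (1%:M - A) = 1%N].

(* A finite subgroup of GL(n, C) is given as the image of a faithful matrix
   representation rG of a finite group G; it acts on C^n by z |-> rG s *m z. *)
Section MatrixGroup.
Context {R : realType} {n : nat} {gT : finGroupType} {G : {group gT}}.
Variable rG : mx_representation (Cplx R) G n.

Definition pseudoreflection_group : Prop :=
  mx_faithful rG /\
  exists2 S : {set gT}, (forall s, s \in S -> pseudoreflection (rG s))
    & <<S>>%g = G.

Definition invariant_set (Omega : set (Cn R n)) : Prop :=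
  forall s, s \in G -> [set rG s *m z | z in Omega] = Omega.

Definition invariant_kernel (Omega : set (Cn R n))
    (K : Cn R n -> Cn R n -> Cplx R) : Prop :=
  forall s, s \in G -> forall z w, Omega z -> Omega w ->
    K (rG s *m z) (rG s *m w) = K z w.

Definition invariant_poly : set (mpoly n (Cplx R)) :=
  [set p | forall s, s \in G -> forall z, peval p (rG s *m z) = peval p z].

Record hsop (theta : n.-tuple (mpoly n (Cplx R))) : Prop := Hsop {
  hsop_homog : forall i, exists d : nat, tnth theta i \is ishomog1 d mdeg;
  hsop_alg_indep : forall q : mpoly n (Cplx R), comp_mpoly theta q = 0 -> q = 0;
  hsop_generate : invariant_poly = range (comp_mpoly theta) }.

Definition reducing_submodule (H : set (Fn R n))
    (dot : Fn R n -> Fn R n -> Cplx R) (M : set (Fn R n)) : Prop :=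
  joint_reducing H dot [set mulop p | p in invariant_poly] M.

Definition Pop (d : nat) (rho : mx_representation (Cplx R) G d) (i j : 'I_d)
    (f : Fn R n) : Fn R n :=
  (d%:R / #|G|%:R : Cplx R) *:
    \sum_(s in G) (rho (s^-1)%g j i *: (f \o (fun z => rG (s^-1)%g *m z))).

End MatrixGroup.

(* The family pi consists of exactly one unitary matrix representation in each
   equivalence class of irreducible representations of G; the index type I
   stands for the set of these classes. *)
Record unitary_dual (R : realType) (gT : finGroupType) (G : {group gT})
    (I : finType) (deg : I -> nat)
    (pi : forall r : I, mx_representation (Cplx R) G (deg r)) : Prop :=
  UnitaryDual {
  ud_irr : forall r, mx_irreducible (pi r);
  ud_unitary : forall r s, s \in G -> pi r s \is unitarymx;
  ud_inj : forall r1 r2, mx_rsim (pi r1) (pi r2) -> r1 = r2;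
  ud_exhaustive : forall (d : nat) (rho : mx_representation (Cplx R) G d),
    mx_irreducible rho -> exists r, mx_rsim rho (pi r) }.

(* Main.v *)
Require Import Defs.
From HB Require Import structures.
From mathcomp Require Import all_boot all_order all_algebra all_fingroup.
From mathcomp Require Import all_character.
From mathcomp Require Import all_classical all_reals all_analysis.
From mathcomp Require Import complex ring lra.
From mathcomp Require Import -(notations) mpoly.

Set Implicit Arguments.
Unset Strict Implicit.
Unset Printing Implicit Defensive.

Import Order.TTheory GRing.Theory Num.Theory numFieldNormedType.Exports.

Local Open Scope classical_set_scope.
Local Open Scope card_scope.
Local Open Scope ring_scope.

(** Translation by s in G, f |-> f o s, maps H onto itself and is unitary, since
the kernel of H is G-invariant: it permutes the functions K(., w), preserves
their inner products, and these functions have dense span.  Density is proved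
with the orthogonal projection onto the span, that is with minimising sequences
and the parallelogram law, and completeness then extends the unitarity from the
span to H.

P_rho^ii is a combination of translations.  Since rho is unitary it is
self-adjoint, by Schur orthogonality it is idempotent, and it commutes with
multiplication by G-invariant polynomials.  The range of such an operator is
closed and stable under these multiplications and under their adjoints, which
is the first claim; the theta_k are themselves G-invariant.

Schur orthogonality also gives P_rho^ii P_rho'^jj = 0 for (rho, i) <> (rho', j),
so the ranges are pairwise orthogonal, and they are pairwise distinct as soon as
none of them is 0.  For this, pick z in Omega whose orbit is free: it exists
because G acts faithfully, so that the points fixed by some s <> 1 lie in
finitely many proper subspaces, which cannot cover an open set.  A polynomial p
with p(z) <> 0 that vanishes on the rest of the orbit satisfies
P_rho^ii p (z) = (deg rho / #|G|) p(z) <> 0. *)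

(** * Schur orthogonality *)

Section SchurOrthogonality.
Variables (F : numClosedFieldType) (gT : finGroupType) (G : {group gT}).

(** Schur's lemma: the row kernel and the row space of an intertwiner are
invariant, hence trivial by irreducibility. *)
Lemma intertwiner_eq0 (d1 d2 : nat) (r1 : mx_representation F G d1)
    (r2 : mx_representation F G d2) (B : 'M[F]_(d1, d2)) :
  mx_irreducible r1 -> mx_irreducible r2 ->
  (forall x, x \in G -> r1 x *m B = B *m r2 x) -> ~ mx_rsim r1 r2 -> B = 0.
Proof.
move=> /mx_irrP[_ irr1] /mx_irrP[_ irr2] homB nsim.
have [//|B0] := eqVneq B 0; case: nsim.
have kB : kermx B == 0.
  apply: contraNT B0 => k0.
  have kfull : row_full (kermx B).
    apply: irr1 k0; apply/mxmoduleP => x Gx; apply/sub_kermxP.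
    by rewrite -mulmxA homB// mulmxA mulmx_ker mul0mx.
  by move: kfull; rewrite -sub1mx => /sub_kermxP; rewrite mul1mx => ->.
have freeB : row_free B by rewrite -kermx_eq0.
have fullB : row_full B.
  suff: row_full <<B>>%MS by rewrite /row_full genmxE.
  apply: irr2.
    rewrite (eqmx_module _ (genmxE B)).
    by apply/mxmoduleP => x Gx; rewrite -homB// submxMl.
  by rewrite -mxrank_eq0 genmxE mxrank_eq0.
apply: (@MxReprSim _ _ _ _ _ _ _ B) => //.
by rewrite -(eqP freeB) (eqP fullB).
Qed.

Lemma intertwiner_scalar (d : nat) (r : mx_representation F G d)
    (B : 'M[F]_d) :
  mx_irreducible r -> (forall x, x \in G -> r x *m B = B *m r x) ->
  exists c, B = c%:M.
Proof.
move=> irr homB; apply/is_scalar_mxP.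
apply: (mx_abs_irr_cent_scalar (group_closure_closed_field irr)).
by apply/centgmxP => x Gx; rewrite homB.
Qed.

(** Averaging turns any matrix into an intertwiner; applied to the elementary
matrices it produces the sums of products of matrix coefficients of the
orthogonality relations. *)
Definition intertwine (d1 d2 : nat) (r1 : mx_representation F G d1)
    (r2 : mx_representation F G d2) (B : 'M[F]_(d1, d2)) :=
  \sum_(s in G) r1 (s^-1)%g *m B *m r2 s.

Lemma intertwineP (d1 d2 : nat) (r1 : mx_representation F G d1)
    (r2 : mx_representation F G d2) (B : 'M[F]_(d1, d2)) x : x \in G ->
  r1 x *m intertwine r1 r2 B = intertwine r1 r2 B *m r2 x.
Proof.
move=> Gx; rewrite /intertwine mulmx_sumr mulmx_suml.
rewrite (reindex_astabs 'R x) /=; last by rewrite astabsR.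
apply: eq_bigr => s Gs; rewrite invMg.
rewrite !mulmxA -repr_mxM ?groupM ?groupV// mulKVg.
by rewrite repr_mxM// !mulmxA.
Qed.

Lemma intertwine_delta (d1 d2 : nat) (r1 : mx_representation F G d1)
    (r2 : mx_representation F G d2) i a b j :
  intertwine r1 r2 (delta_mx a b) i j =
  \sum_(s in G) r1 (s^-1)%g i a * r2 s b j.
Proof.
rewrite summxE; apply: eq_bigr => s _.
rewrite mxE (bigD1 b)//= big1 ?addr0 => [|k kb].
  rewrite mxE (bigD1 a)//= big1 ?addr0 => [|k ka].
    by rewrite mxE !eqxx mulr1.
  by rewrite mxE (negPf ka) mulr0.
rewrite mxE big1 ?mul0r// => l _.
by rewrite mxE (negPf kb) andbF mulr0.
Qed.

Lemma schur_orthogonality_neq (d1 d2 : nat) (r1 : mx_representation F G d1)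
    (r2 : mx_representation F G d2) i a b j :
  mx_irreducible r1 -> mx_irreducible r2 -> ~ mx_rsim r1 r2 ->
  \sum_(s in G) r1 (s^-1)%g i a * r2 s b j = 0.
Proof.
move=> irr1 irr2 nsim; rewrite -intertwine_delta.
have -> : intertwine r1 r2 (delta_mx a b) = 0; last by rewrite mxE.
by apply: (intertwiner_eq0 irr1 irr2) nsim => x; exact: intertwineP.
Qed.

(** The average of an elementary matrix is a scalar matrix, and the scalar is read
off from the trace. *)
Lemma schur_orthogonality_eq (d : nat) (r : mx_representation F G d) i a b j :
  mx_irreducible r ->
  \sum_(s in G) r (s^-1)%g i a * r s b j =
  #|G|%:R / d%:R * ((i == j) && (a == b))%:R.
Proof.
move=> irr; rewrite -intertwine_delta.
have [c Bc] := intertwiner_scalar irr (@intertwineP _ _ r r (delta_mx a b)).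
have d0 : d%:R != 0 :> F by rewrite pnatr_eq0 -lt0n; case/mx_irrP: irr.
have : \tr (intertwine r r (delta_mx a b)) = #|G|%:R * (a == b)%:R.
  rewrite raddf_sum /= (eq_bigr (fun=> (a == b)%:R)) => [|s Gs].
    by rewrite sumr_const mulr_natl.
  rewrite mxtrace_mulC mulmxA -repr_mxM ?groupV//.
  rewrite mulgV repr_mx1 mul1mx /mxtrace (bigD1 a)//= big1 => [|k ka].
    by rewrite mxE eqxx addr0.
  by rewrite mxE (negPf ka).
rewrite Bc mxtrace_scalar mxE -[c *+ d]mulr_natr => cE.
rewrite -(mulfK d0 c) cE mulrAC -mulrnAr; congr (_ * _).
by case: eqP; case: eqP.
Qed.

End SchurOrthogonality.

(** * Points with free orbit and polynomials separating an orbit *)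

Section FreeOrbit.
Variables (R : realType) (n : nat).
Local Notation C := (Cplx R).

(** On the curve z0 + (t, t^2, ..., t^n) any nonzero linear form is a nonzero
polynomial in t, so that a proper subspace contains only finitely many of its
points. *)
Definition moment_curve (z0 : Cn R n) (t : C) : Cn R n :=
  \col_j (z0 j 0 + t ^+ j.+1).

Lemma moment_curve_kernel (z0 : Cn R n) (A : 'M[C]_n) : A != 0 ->
  exists2 q : {poly C}, q != 0 &
    forall t, A *m moment_curve z0 t = 0 -> root q t.
Proof.
move=> A0; have [i [j Aij]] : exists i j, A i j != 0.
  apply/not_existsP => h; move/eqP: A0; apply; apply/matrixP => i j.
  rewrite mxE; apply/eqP; apply/negP => /negP Aij.
  by apply: (h i); exists j.
pose q := (\sum_k A i k * z0 k 0)%:P + \sum_(k < n) A i k *: 'X ^+ k.+1.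
exists q.
  apply/eqP => /(congr1 (fun p : {poly C} => p`_j.+1)).
  rewrite coef0 coefD coefC /= add0r coef_sum (bigD1 j)//= big1 => [|k kj].
    by rewrite coefZ coefXn eqxx mulr1 addr0; exact/eqP.
  by rewrite coefZ coefXn eqSS eq_sym (negPf (kj : k != j :> nat)) mulr0.
move=> t /matrixP/(_ i 0); rewrite !mxE => At.
apply/rootP; rewrite hornerD hornerC horner_sum -big_split/= -[RHS]At.
by apply: eq_bigr => k _; rewrite hornerZ hornerXn mxE mulrDr.
Qed.

(** Both bounds are wanted because a number t with |t| <= 1 satisfies |t^k| <= |t|
for k > 0, so that a small t gives a point of the moment curve close to z0. *)
Lemma small_nonroot (q : {poly C}) (e : C) : q != 0 -> 0 < e ->
  exists2 t, `|t| <= 1 /\ `|t| < e & ~~ root q t.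
Proof.
move=> q0 e0.
pose u (k : nat) : C := Num.min 1 (e / 2) / k.+1%:R.
have m0 : 0 < Num.min 1 (e / 2).
  by rewrite /Num.min; case: ifP => // _; rewrite divr_gt0.
have um k : 0 < u k by rewrite divr_gt0.
have ule k : u k <= Num.min 1 (e / 2).
  by rewrite ler_pdivrMr// ler_peMr//; [exact: ltW|rewrite ler1n].
have cmp : (1 >=< e / 2)%O.
  by apply: real_comparable; rewrite ?realE ?ler01// (ltW (divr_gt0 e0 _)).
have u1 k : u k <= 1.
  by apply: le_trans (ule k) _; rewrite comparable_ge_min// lexx.
have ue k : u k < e.
  apply: le_lt_trans (ule k) _; apply: (@le_lt_trans _ _ (e / 2)).
    by rewrite comparable_ge_min// lexx orbT.
  by rewrite ltr_pdivrMr// mulr_natr mulr2n ltrDl.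
have uinj : injective u.
  move=> j k /(mulfI (lt0r_neq0 m0))/invr_inj/eqP.
  by rewrite eqr_nat eqSS => /eqP.
pose s := [seq u k | k <- iota 0 (size q)].
have us : uniq s by rewrite map_inj_uniq// iota_uniq.
have [/(max_poly_roots q0)/(_ us)|] := boolP (all (root q) s).
  by rewrite size_map size_iota ltnn.
case/allPn => _ /mapP[k _ ->] nr; exists (u k) => //.
by rewrite gtr0_norm.
Qed.

Lemma moment_curve_near (Omega : set (Cn R n)) (z0 : Cn R n) :
  open Omega -> Omega z0 ->
  exists2 e : C, 0 < e &
    forall t, `|t| <= 1 -> `|t| < e -> Omega (moment_curve z0 t).
Proof.
move=> oO Oz0.
have /nbhs_ballP[e /= e0 eO] : nbhs z0 Omega by apply: open_nbhs_nbhs.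
exists e => // t t1 te; apply: eO; split=> // i j.
rewrite /ball/= !mxE ord1 opprD addNKr normrN normrX exprS.
apply: le_lt_trans te.
by rewrite ler_piMr// exprn_ile1.
Qed.

(** Faithfulness makes rG s - 1 nonzero for s <> 1; the moment curve through a
point of Omega leaves all the kernels of these matrices at once. *)
Lemma free_orbit_point (gT : finGroupType) (G : {group gT})
    (rG : mx_representation C G n) (Omega : set (Cn R n)) :
  mx_faithful rG -> open Omega -> Omega !=set0 ->
  exists2 z, Omega z & forall s, s \in G -> s != 1%g -> rG s *m z != z.
Proof.
move=> fG oO [z0 Oz0].
have /choice[q qP] : forall s, exists q : {poly C}, q != 0 /\
    (s \in G -> s != 1%g ->
      forall t, rG s *m moment_curve z0 t = moment_curve z0 t -> root q t).
  move=> s; have [Gs|] := boolP ((s \in G) && (s != 1%g)); last first.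
    rewrite negb_and => h; exists 1; split; first exact: oner_neq0.
    by move=> Gs s1; move: h; rewrite Gs s1.
  case/andP: Gs => Gs s1.
  have /(moment_curve_kernel z0)[q q0 qP] : rG s - 1%:M != 0.
    rewrite subr_eq0; apply: contra s1 => /eqP rs1.
    have : s \in rker rG by rewrite inE Gs mul1mx rs1 eqxx.
    by move/(fintype.subsetP fG); rewrite inE.
  exists q; split=> // _ _ t fixt; apply: qP.
  by rewrite mulmxBl mul1mx fixt subrr.
have Q0 : \prod_(s in G) q s != 0.
  by apply/prodf_neq0 => s _; case: (qP s).
have [e e0 eO] := moment_curve_near oO Oz0.
have [t [t1 te] nr] := small_nonroot Q0 e0.
exists (moment_curve z0 t); first exact: eO.
move=> s Gs s1; apply: contra nr => /eqP fixt.
rewrite (bigD1 s)//= rootM; apply/orP; left.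
by case: (qP s) => _; apply.
Qed.

Lemma separating_poly (J : finType) (P : pred J) (z : Cn R n)
    (w : J -> Cn R n) : (forall k, P k -> w k != z) ->
  exists2 p : mpoly n C, peval p z != 0 & forall k, P k -> peval p (w k) = 0.
Proof.
move=> wz.
have /choice[p pP] : forall k, exists p : mpoly n C,
    peval p z != 0 /\ (P k -> peval p (w k) = 0).
  move=> k; have [Pk|nPk] := boolP (P k); last first.
    by exists 1; split => //; rewrite /peval meval1 oner_neq0.
  have [i wi] : exists i, w k i 0 != z i 0.
    apply/not_existsP => h; move/eqP: (wz k Pk); apply; apply/colP => i.
    by apply/eqP/negP => /negP; exact: h.
  exists (mpolyX _ (mnm1 i) - mpolyC _ (w k i 0)).
  rewrite /peval !mevalB !mevalXU !mevalC subrr subr_eq0.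
  by split=> //; rewrite eq_sym.
exists (\prod_(k | P k) p k).
  rewrite /peval rmorph_prod; apply/prodf_neq0 => k _.
  by case: (pP k).
move=> k Pk; rewrite /peval (bigD1 k)//= mevalM.
by have [_ /(_ Pk)] := pP k; rewrite /peval => ->; rewrite mul0r.
Qed.

End FreeOrbit.

(** * Hilbert spaces of functions *)

Lemma Cplx_ext (R : realType) (x y : Cplx R) :
  complex.Re x = complex.Re y -> complex.Im x = complex.Im y -> x = y.
Proof. by case: x y => [a b] [c d] /= -> ->. Qed.

Section PreHilbert.
Variables (R : realType) (n : nat) (H : set (Fn R n)).
Variable dot : Fn R n -> Fn R n -> Cplx R.
Hypothesis hs : hilbert_space H dot.
Local Notation C := (Cplx R).

(** The real part of the inner product is a real symmetric form, which makes the
usual quadratic arguments available over an ordered field. *)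
Definition rdot (f g : Fn R n) : R := complex.Re (dot f g).

Lemma hs0 : H 0.
Proof. by have [/[!inE]] := hs_submod hs. Qed.

Lemma hsDZ (a : C) f g : H f -> H g -> H (a *: f + g).
Proof.
by move=> Hf Hg; have [_ /(_ a f g)/[!inE]] := hs_submod hs; apply.
Qed.

Lemma hsD f g : H f -> H g -> H (f + g).
Proof. by move=> Hf Hg; rewrite -[f]scale1r; exact: hsDZ. Qed.

Lemma hsZ (a : C) f : H f -> H (a *: f).
Proof. by move=> Hf; rewrite -[_ *: _]addr0; apply: hsDZ => //; exact: hs0. Qed.

Lemma hsN f : H f -> H (- f).
Proof. by move=> Hf; rewrite -scaleN1r; exact: hsZ. Qed.

Lemma hsB f g : H f -> H g -> H (f - g).
Proof. by move=> Hf Hg; apply: hsD => //; exact: hsN. Qed.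

Lemma hs_sum (J : finType) (P : pred J) (F : J -> Fn R n) :
  (forall j, P j -> H (F j)) -> H (\sum_(j | P j) F j).
Proof. by move=> HF; apply: big_ind => //; [exact: hs0|exact: hsD]. Qed.

Lemma dotDl f g h : H f -> H g -> H h -> dot (f + g) h = dot f h + dot g h.
Proof.
by move=> Hf Hg Hh; have := hs_linear hs 1 Hf Hg Hh; rewrite scale1r mul1r.
Qed.

Lemma dot0l h : H h -> dot 0 h = 0.
Proof.
move=> Hh; have := dotDl hs0 hs0 Hh; rewrite addr0.
by move=> /(congr1 (fun x => x - dot 0 h)); rewrite subrr addrK => <-.
Qed.

Lemma dotZl (a : C) f h : H f -> H h -> dot (a *: f) h = a * dot f h.
Proof.
move=> Hf Hh; have := hs_linear hs a Hf hs0 Hh.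
by rewrite addr0 dot0l// addr0.
Qed.

Lemma dotNl f h : H f -> H h -> dot (- f) h = - dot f h.
Proof. by move=> Hf Hh; rewrite -scaleN1r dotZl// mulN1r. Qed.

Lemma dotBl f g h : H f -> H g -> H h -> dot (f - g) h = dot f h - dot g h.
Proof. by move=> Hf Hg Hh; rewrite dotDl// ?dotNl//; exact: hsN. Qed.

Lemma dot_suml (J : finType) (P : pred J) (F : J -> Fn R n) h : H h ->
  (forall j, P j -> H (F j)) ->
  dot (\sum_(j | P j) F j) h = \sum_(j | P j) dot (F j) h.
Proof.
move=> Hh HF.
suff : H (\sum_(j | P j) F j) /\
    dot (\sum_(j | P j) F j) h = \sum_(j | P j) dot (F j) h by case.
apply: (big_ind2 (fun f c => H f /\ dot f h = c)).
- by split; [exact: hs0|exact: dot0l].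
- by move=> f c g d [Hf <-] [Hg <-]; split; [exact: hsD|exact: dotDl].
- by move=> j Pj; split => //; exact: HF.
Qed.

Lemma dotDr f g h : H f -> H g -> H h -> dot h (f + g) = dot h f + dot h g.
Proof.
move=> Hf Hg Hh; rewrite (hs_conj hs (hsD Hf Hg) Hh) dotDl// rmorphD.
by rewrite (hs_conj hs Hf Hh) (hs_conj hs Hg Hh).
Qed.

Lemma dotZr (a : C) f h : H f -> H h -> dot h (a *: f) = a^* * dot h f.
Proof.
move=> Hf Hh; rewrite (hs_conj hs (hsZ a Hf) Hh) dotZl// rmorphM.
by rewrite (hs_conj hs Hf Hh).
Qed.

Lemma dotBr f g h : H f -> H g -> H h -> dot h (f - g) = dot h f - dot h g.
Proof.
move=> Hf Hg Hh; rewrite -scaleN1r dotDr ?dotZr//; last exact: hsZ.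
by rewrite rmorphN rmorph1 mulN1r.
Qed.

Lemma dot_sumr (J : finType) (P : pred J) (F : J -> Fn R n) h : H h ->
  (forall j, P j -> H (F j)) ->
  dot h (\sum_(j | P j) F j) = \sum_(j | P j) dot h (F j).
Proof.
move=> Hh HF; rewrite (hs_conj hs (hs_sum HF) Hh) dot_suml// rmorph_sum.
by apply: eq_bigr => j Pj; rewrite (hs_conj hs (HF j Pj) Hh).
Qed.

Lemma dot_ge0 f : H f -> 0 <= dot f f.
Proof.
move=> Hf; have [->|f0] := eqVneq f 0; first by rewrite dot0l//; exact: hs0.
exact/ltW/(hs_pos hs).
Qed.

Lemma dot_eq0 f : H f -> dot f f = 0 -> f = 0.
Proof.
move=> Hf f0; apply/eqP/negP => /negP /(hs_pos hs Hf).
by rewrite f0 ltxx.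
Qed.

Lemma rdot_ge0 f : H f -> 0 <= rdot f f.
Proof. by move=> /dot_ge0; rewrite lecE => /andP[]. Qed.

Lemma rdot_eq0 f : H f -> rdot f f = 0 -> f = 0.
Proof.
move=> Hf f0; apply: dot_eq0 => //; apply/eqP.
rewrite eq_complex; move: (dot_ge0 Hf); rewrite lecE => /andP[-> _].
by rewrite andbT; apply/eqP.
Qed.

Lemma rdotC f g : H f -> H g -> rdot g f = rdot f g.
Proof.
move=> Hf Hg; rewrite /rdot (hs_conj hs Hf Hg).
by case: (dot f g).
Qed.

Lemma rdotDl f g h : H f -> H g -> H h -> rdot (f + g) h = rdot f h + rdot g h.
Proof. by move=> Hf Hg Hh; rewrite /rdot dotDl//; case: dot; case: dot. Qed.

Lemma rdotZl (a : R) f h : H f -> H h ->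
  rdot ((a%:C)%C *: f) h = a * rdot f h.
Proof.
move=> Hf Hh; rewrite /rdot dotZl//; case: dot => x y.
by rewrite /= mul0r subr0.
Qed.

Lemma rdotNl f h : H f -> H h -> rdot (- f) h = - rdot f h.
Proof. by move=> Hf Hh; rewrite /rdot dotNl//; case: dot. Qed.

Lemma rdotBl f g h : H f -> H g -> H h -> rdot (f - g) h = rdot f h - rdot g h.
Proof. by move=> Hf Hg Hh; rewrite rdotDl// ?rdotNl//; exact: hsN. Qed.

(** The real form determines the inner product. *)
Lemma Im_dot f g : H f -> H g ->
  complex.Im (dot f g) = rdot ((- 'i%C : C) *: f) g.
Proof.
move=> Hf Hg; rewrite /rdot dotZl//; case: dot => x y /=.
by rewrite oppr0 mul0r sub0r mulN1r opprK.
Qed.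

Lemma rdot_lin f g (t : R) : H f -> H g ->
  rdot (f + (t%:C)%C *: g) (f + (t%:C)%C *: g) =
  rdot f f + 2 * t * rdot f g + t ^+ 2 * rdot g g.
Proof.
move=> Hf Hg; have Htg := hsZ ((t%:C)%C : C) Hg.
have Hs := hsD Hf Htg.
rewrite rdotDl// (rdotC Hs Hf) (rdotC Hs Htg) !rdotDl// !rdotZl// (rdotC Htg Hg).
rewrite !rdotZl// (rdotC Htg Hf) rdotZl// (rdotC Hg Hf).
by rewrite expr2; ring.
Qed.

Lemma hnorm_ge0 f : 0 <= hnorm dot f.
Proof. exact: sqrtr_ge0. Qed.

Lemma hnorm_sqr f : H f -> hnorm dot f ^+ 2 = rdot f f.
Proof. by move=> Hf; rewrite sqr_sqrtr// rdot_ge0. Qed.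

Lemma cauchy_schwarz f g : H f -> H g ->
  `|rdot f g| <= hnorm dot f * hnorm dot g.
Proof.
move=> Hf Hg; have [->|g0] := eqVneq g 0.
  rewrite (rdotC hs0 Hf) /rdot dot0l// normr0.
  by rewrite mulr_ge0// hnorm_ge0.
have y0 : 0 < rdot g g.
  by rewrite lt_def rdot_ge0// andbT; apply: contra g0 => /eqP/rdot_eq0 ->.
rewrite -(@ler_pXn2r _ 2)// ?nnegrE ?mulr_ge0 ?hnorm_ge0//.
rewrite real_normK ?num_real// exprMn !hnorm_sqr//.
rewrite -ler_pdivrMr// -subr_ge0.
have := rdot_ge0 (hsD Hf (hsZ (((- rdot f g / rdot g g)%:C)%C : C) Hg)).
rewrite rdot_lin// => /le_trans; apply; rewrite le_eqVlt; apply/orP; left.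
by apply/eqP; field; rewrite gt_eqF.
Qed.

Lemma hnorm_triangle f g : H f -> H g ->
  hnorm dot (f + g) <= hnorm dot f + hnorm dot g.
Proof.
move=> Hf Hg; rewrite -(@ler_pXn2r _ 2)// ?nnegrE ?addr_ge0 ?hnorm_ge0//.
rewrite hnorm_sqr; last exact: hsD.
have := @rdot_lin f g 1 Hf Hg; rewrite scale1r => ->.
have := le_trans (ler_norm _) (cauchy_schwarz Hf Hg).
by rewrite sqrrD !hnorm_sqr//; lra.
Qed.

Lemma hnorm_opp f : H f -> hnorm dot (- f) = hnorm dot f.
Proof.
move=> Hf; rewrite /hnorm -scaleN1r dotZl ?dotZr//; last exact: hsZ.
by rewrite mulrA rmorphN rmorph1 mulrNN !mul1r.
Qed.

Lemma hnorm_sub f g : H f -> H g -> hnorm dot (f - g) = hnorm dot (g - f).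
Proof. by move=> Hf Hg; rewrite -opprB hnorm_opp//; exact: hsB. Qed.

Lemma hnorm_dist f g : H f -> H g ->
  `|hnorm dot f - hnorm dot g| <= hnorm dot (f - g).
Proof.
move=> Hf Hg; rewrite ler_norml; apply/andP; split.
  rewrite lerNl opprB lerBlDr (hnorm_sub Hf Hg).
  by rewrite -{1}[g](subrK f) hnorm_triangle//; exact: hsB.
by rewrite lerBlDr -{1}[f](subrK g) hnorm_triangle//; exact: hsB.
Qed.

Lemma hnorm_cvg0P (v : nat -> Fn R n) :
  hnorm dot (v k) @[k --> \oo] --> (0 : R) <->
  forall e : R, 0 < e -> exists N : nat, forall k, (N <= k)%N ->
    hnorm dot (v k) < e.
Proof.
split=> [/cvgrPdist_lt h e /h [N _ NP]|h].
  exists N => k /NP; rewrite /= sub0r normrN.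
  by rewrite ger0_norm ?hnorm_ge0.
apply/cvgrPdist_lt => e /h[N NP]; exists N => // k /NP /=.
by rewrite sub0r normrN ger0_norm ?hnorm_ge0.
Qed.

Lemma rdot_cvg (u : nat -> Fn R n) f h :
  (forall k, H (u k)) -> H f -> H h ->
  hnorm dot (u k - f) @[k --> \oo] --> (0 : R) ->
  rdot (u k) h @[k --> \oo] --> rdot f h.
Proof.
move=> Hu Hf Hh /hnorm_cvg0P ucv; apply/cvgrPdist_lt => e e0.
have hh : 0 < hnorm dot h + 1 by rewrite ltr_wpDl ?hnorm_ge0.
have [N NP] := ucv _ (divr_gt0 e0 hh).
exists N => // k /NP; rewrite ltr_pdivlMr//=; apply: le_lt_trans.
rewrite distrC -rdotBl//.
apply: le_trans (cauchy_schwarz (hsB (Hu k) Hf) Hh) _.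
by rewrite ler_wpM2l ?hnorm_ge0// lerDl.
Qed.

Lemma hnorm_cvg (u : nat -> Fn R n) f :
  (forall k, H (u k)) -> H f ->
  hnorm dot (u k - f) @[k --> \oo] --> (0 : R) ->
  hnorm dot (u k) @[k --> \oo] --> hnorm dot f.
Proof.
move=> Hu Hf /hnorm_cvg0P ucv; apply/cvgrPdist_lt => e /ucv[N NP].
exists N => // k /NP; apply: le_lt_trans.
by rewrite distrC hnorm_dist.
Qed.

Lemma parallelogram f g : H f -> H g ->
  rdot (f - g) (f - g) =
  2 * rdot f f + 2 * rdot g g - rdot (f + g) (f + g).
Proof.
move=> Hf Hg; have := @rdot_lin f g 1 Hf Hg; have := @rdot_lin f g (-1) Hf Hg.
rewrite rmorphN rmorph1 scaleN1r scale1r => -> ->; ring.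
Qed.

(** For q > 0 this is the inequality at its best t, namely x / q.  For q = 0 the
hypothesis bounds the multiples of x, which forces x = 0. *)
Lemma small_quadratic (x q d : R) : 0 <= q ->
  (forall t : R, 2 * t * x <= t ^+ 2 * q + d) -> x ^+ 2 <= q * d.
Proof.
move=> q0 h; have [q00|qn0] := eqVneq q 0.
  rewrite q00 mul0r; have [->|x0] := eqVneq x 0; first by rewrite expr0n.
  (* The value of t at which the left hand side exceeds d. *)
  have := h ((d + 1) / (2 * x)); rewrite q00 mulr0 add0r.
  rewrite (_ : 2 * _ * x = d + 1); last by field.
  by rewrite gerDl ler10.
have qp : 0 < q by rewrite lt_def qn0.
have := h (x / q); rewrite -lerBlDl.
rewrite (_ : _ - _ = x ^+ 2 / q); last by field.
by rewrite ler_pdivrMr// mulrC.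
Qed.

(** Hilbert's projection argument: the functions of D whose distance to f tends to
the infimum form a Cauchy sequence, by the parallelogram law, and f minus its
limit is orthogonal to D, hence zero. *)
Lemma total_dense (D : set (Fn R n)) :
  D `<=` H -> D 0 -> (forall (a : C) f g, D f -> D g -> D (a *: f + g)) ->
  (forall f, H f -> (forall u, D u -> dot f u = 0) -> f = 0) ->
  forall f, H f -> forall e : R, 0 < e ->
    exists2 u, D u & hnorm dot (f - u) < e.
Proof.
move=> DH D0 Dlin Dtot f Hf e e0.
pose S := [set rdot (f - u) (f - u) | u in D].
have S0 : S !=set0 by exists (rdot (f - 0) (f - 0)); exists 0.
have Slb : lbound S 0 by move=> _ [u Du <-]; apply/rdot_ge0/hsB => //; exact: DH.
have Sinf : has_inf S by split => //; exists 0.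
have dle u : D u -> inf S <= rdot (f - u) (f - u).
  by move=> Du; apply: ge_inf; [exists 0|exists u].
have /choice[u uP] : forall k : nat, exists u, D u /\
    rdot (f - u) (f - u) < inf S + k.+1%:R^-1.
  move=> k; have k0 : 0 < k.+1%:R^-1 :> R by rewrite invr_gt0.
  by have [_ [v Dv <-] vlt] := inf_adherent k0 Sinf; exists v.
have Hu k : H (u k) by apply: DH; case: (uP k).
have cauchy j k : rdot (u j - u k) (u j - u k) <=
    2 * j.+1%:R^-1 + 2 * k.+1%:R^-1.
  have [Dj /ltW ltj] := uP j; have [Dk /ltW ltk] := uP k.
  have -> : u j - u k = (f - u k) - (f - u j).
    by rewrite opprB [RHS]addrC addrA subrK.
  rewrite parallelogram; [|exact: hsB|exact: hsB].
  have := dle _ (Dlin (2^-1) _ _ (Dlin 1 _ _ Dj Dk) D0).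
  set m := _ + 0.
  (* m is the midpoint of u j and u k; it lies in D, so that its distance to f
  is bounded below by the infimum. *)
  have -> : (f - u k) + (f - u j) = ((2 : R)%:C)%C *: (f - m).
    rewrite /m addr0 scale1r scalerBr scalerA.
    rewrite (_ : _ * _ = 1 :> C) ?scale1r; last first.
      by rewrite rmorphMn rmorph1 mulfV ?pnatr_eq0.
    by rewrite rmorphMn rmorph1 scaler_nat mulr2n opprD addrACA [- u k - _]addrC.
  have Hm : H (f - m).
    apply: hsB => //; apply: DH; apply: (Dlin _ _ _ _ D0).
    exact: Dlin.
  rewrite rdotZl//; last exact: hsZ.
  rewrite rdotC ?rdotZl//; last exact: hsZ.
  move: ltj ltk; move: (j.+1%:R^-1) (k.+1%:R^-1) => a b; lra.
have [|g Hg gcv] := hs_complete hs Hu.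
  move=> d d0; exists (Num.truncn (4 / d ^+ 2)) => j k jN kN.
  rewrite -(@ltr_pXn2r _ 2)// ?nnegrE ?hnorm_ge0 ?(ltW d0)//.
  rewrite hnorm_sqr; last exact: hsB.
  apply: le_lt_trans (cauchy j k) _.
  have inv_small i : (Num.truncn (4 / d ^+ 2) <= i)%N -> i.+1%:R^-1 < d ^+ 2 / 4.
    move=> iN; rewrite invf_plt ?posrE ?divr_gt0 ?exprn_gt0// invf_div.
    apply: lt_le_trans (truncnS_gt _) _.
    by rewrite ler_nat ltnS.
  have := inv_small _ jN; have := inv_small _ kN.
  by move: (j.+1%:R^-1) (k.+1%:R^-1) => a b; lra.
have perp v : D v -> rdot (f - g) v = 0.
  move=> Dv; have Hv := DH _ Dv.
  have : rdot (f - u k) v @[k --> \oo] --> rdot (f - g) v.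
    apply: rdot_cvg => //; [by move=> k; exact: hsB|exact: hsB|].
    apply/hnorm_cvg0P => d d0; move/hnorm_cvg0P: gcv => /(_ d d0)[N NP].
    exists N => k kN; rewrite opprB addrC addrA subrK hnorm_sub//.
    exact: NP.
  move=> /cvg_unique; apply => //; apply/cvgrPdist_lt => d d0.
  have q0 := rdot_ge0 Hv.
  exists (Num.truncn (rdot v v / d ^+ 2)) => // k /= kN.
  rewrite sub0r normrN -(@ltr_pXn2r _ 2)// ?nnegrE ?(ltW d0)//.
  rewrite real_normK ?num_real//.
  apply: (@le_lt_trans _ _ (rdot v v * k.+1%:R^-1)); last first.
    rewrite ltr_pdivrMr// mulrC -ltr_pdivrMr ?exprn_gt0//.
    apply: lt_le_trans (truncnS_gt _) _.
    by rewrite ler_nat ltnS.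
  apply: small_quadratic => // t.
  have [Dk ltk] := uP k.
  have := dle _ (Dlin ((t%:C)%C : C) _ _ Dv Dk).
  rewrite (_ : f - _ = (f - u k) + ((- t)%:C)%C *: v); last first.
    by rewrite rmorphN scaleNr opprD addrA addrAC.
  rewrite rdot_lin//; last exact: hsB.
  by rewrite sqrrN; move: ltk; move: (k.+1%:R^-1) => c; lra.
have -> : f = g.
  apply/eqP; rewrite -subr_eq0; apply/eqP; apply: Dtot => [|v Dv]; first exact: hsB.
  have Hfg := hsB Hf Hg; have Hv := DH _ Dv.
  apply: Cplx_ext; first exact: perp.
  have := perp _ (Dlin (- 'i%C : C) _ _ Dv D0); rewrite addr0 /rdot dotZr//.
  by case: (dot (f - g) v) => x y /= h; lra.
move/hnorm_cvg0P: gcv => /(_ e e0)[N /(_ N (leqnn _)) lte].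
by exists (u N); [case: (uP N)|rewrite hnorm_sub].
Qed.

End PreHilbert.

(** * Translations are unitary on a space with invariant kernel *)

Section InvariantKernel.
Variables (R : realType) (n : nat) (gT : finGroupType) (G : {group gT}).
Variable rG : mx_representation (Cplx R) G n.
Variables (Omega : set (Cn R n)) (H : set (Fn R n)).
Variables (dot : Fn R n -> Fn R n -> Cplx R) (K : Cn R n -> Cn R n -> Cplx R).
Hypotheses (hinv : invariant_set rG Omega) (hK : invariant_kernel rG Omega K).
Hypotheses (hs : hilbert_space H dot) (HO : H `<=` holo Omega).
Hypothesis rk : reproducing_kernel Omega H dot K.
Local Notation C := (Cplx R).

Definition translate (s : gT) (f : Fn R n) : Fn R n :=
  f \o (fun z => rG s *m z).

Definition kernel_at (w : Cn R n) : Fn R n := ext0 Omega (K^~ w).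

Inductive kernel_span : Fn R n -> Prop :=
| kernel_span0 : kernel_span 0
| kernel_spanS (a : C) w f : Omega w -> kernel_span f ->
    kernel_span (a *: kernel_at w + f).

Lemma invariant_set_mem s z : s \in G -> Omega z -> Omega (rG s *m z).
Proof. by move=> Gs Oz; rewrite -(hinv Gs); exists z. Qed.

Lemma repr_mulVK s (z : Cn R n) : s \in G ->
  rG s *m (rG s^-1%g *m z) = z.
Proof.
by move=> Gs; rewrite mulmxA -repr_mxM ?groupV// mulgV repr_mx1 mul1mx.
Qed.

Lemma repr_mulKV s (z : Cn R n) : s \in G ->
  rG s^-1%g *m (rG s *m z) = z.
Proof.
by move=> Gs; rewrite mulmxA -repr_mxM ?groupV// mulVg repr_mx1 mul1mx.
Qed.

Lemma invariant_setE s z : s \in G -> Omega (rG s *m z) <-> Omega z.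
Proof.
move=> Gs; split; last exact: invariant_set_mem.
move=> Osz; rewrite -(repr_mulKV z Gs).
by apply: invariant_set_mem; rewrite ?groupV.
Qed.

Lemma ext0_in f z : Omega z -> ext0 Omega f z = f z.
Proof. by move=> Oz; rewrite /ext0 patchT// inE. Qed.

Lemma ext0_out f z : ~ Omega z -> ext0 Omega f z = 0.
Proof. by move=> Oz; rewrite /ext0 patchC// inE. Qed.

Lemma kernel_at_H w : Omega w -> H (kernel_at w).
Proof. by case/rk. Qed.

Lemma dot_kernel_at f w : H f -> Omega w -> dot f (kernel_at w) = f w.
Proof. by move=> Hf /rk[_]; apply. Qed.

Lemma kernel_span_H f : kernel_span f -> H f.
Proof.
elim=> [|a w g Ow _ Hg]; first exact: (hs0 hs).
by apply: (hsDZ hs) => //; exact: kernel_at_H.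
Qed.

Lemma kernel_span_lin a f g :
  kernel_span f -> kernel_span g -> kernel_span (a *: f + g).
Proof.
move=> Sf Sg; elim: Sf => [|b w h Ow _ IH]; first by rewrite scaler0 add0r.
by rewrite scalerDr scalerA -addrA; exact: kernel_spanS.
Qed.

(** A function orthogonal to all the K(., w) vanishes, by the reproducing
property. *)
Lemma kernel_span_dense f : H f -> forall e : R, 0 < e ->
  exists2 u, kernel_span u & hnorm dot (f - u) < e.
Proof.
apply: (total_dense hs).
- exact: kernel_span_H.
- exact: kernel_span0.
- exact: kernel_span_lin.
move=> g Hg gperp; apply/funext => z.
have [Oz|nOz] := pselect (Omega z); last by have [_ ->] := HO Hg.
rewrite -(dot_kernel_at Hg Oz) gperp//.
rewrite -[kernel_at z]addr0 -[kernel_at z]scale1r.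
by apply: kernel_spanS => //; exact: kernel_span0.
Qed.

Lemma translate_lin s a f g :
  translate s (a *: f + g) = a *: translate s f + translate s g.
Proof. by []. Qed.

Lemma translateD s f g : translate s (f + g) = translate s f + translate s g.
Proof. by []. Qed.

Lemma translateB s f g : translate s (f - g) = translate s f - translate s g.
Proof. by []. Qed.

Lemma translate_kernel_at s w : s \in G -> Omega w ->
  translate s (kernel_at w) = kernel_at (rG s^-1%g *m w).
Proof.
move=> Gs Ow; apply/funext => z; rewrite /translate /kernel_at /=.
have [Oz|nOz] := pselect (Omega z); last first.
  by rewrite !ext0_out// invariant_setE.
rewrite !ext0_in//; last exact: invariant_set_mem.
rewrite -{1}(repr_mulVK w Gs) hK//; apply: invariant_set_mem => //.
by rewrite groupV.
Qed.

Lemma translate_span s f : s \in G -> kernel_span f ->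
  kernel_span (translate s f).
Proof.
move=> Gs; elim=> [|a w g Ow _ IH]; first exact: kernel_span0.
rewrite translate_lin translate_kernel_at//; apply: kernel_spanS => //.
by apply: invariant_set_mem; rewrite ?groupV.
Qed.

(** It suffices to take g = K(., w), where both sides equal f(w). *)
Lemma dot_translate_span s f g : s \in G -> kernel_span f -> kernel_span g ->
  dot (translate s f) (translate s g) = dot f g.
Proof.
move=> Gs Sf; have Hf := kernel_span_H Sf.
have Hsf := kernel_span_H (translate_span Gs Sf).
elim=> [|a w h Ow Sh IH].
  have -> : translate s 0 = 0 by [].
  by rewrite (hs_conj hs (hs0 hs) Hsf) (hs_conj hs (hs0 hs) Hf) !(dot0l hs).
have Osw : Omega (rG s^-1%g *m w) by apply: invariant_set_mem; rewrite ?groupV.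
have Hh := kernel_span_H Sh; have Hsh := kernel_span_H (translate_span Gs Sh).
have Hk := kernel_at_H Ow; have Hsk := kernel_at_H Osw.
rewrite translate_lin translate_kernel_at// !(dotDr hs)// ?IH ?(dotZr hs)//.
- by rewrite !dot_kernel_at// /translate/= repr_mulVK.
- exact: (hsZ hs).
- exact: (hsZ hs).
Qed.

Lemma hnorm_translate_span s f : s \in G -> kernel_span f ->
  hnorm dot (translate s f) = hnorm dot f.
Proof. by move=> Gs Sf; rewrite /hnorm dot_translate_span. Qed.

Lemma kernel_spanB f g : kernel_span f -> kernel_span g -> kernel_span (f - g).
Proof. by move=> Sf Sg; rewrite addrC -scaleN1r; exact: kernel_span_lin. Qed.

(** Evaluation at w is continuous.  The factor a gives access to the imaginary
part. *)
Lemma eval_cvg (a : C) (u : nat -> Fn R n) f w :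
  (forall k, H (u k)) -> H f -> Omega w ->
  hnorm dot (u k - f) @[k --> \oo] --> (0 : R) ->
  complex.Re (a * u k w) @[k --> \oo] --> complex.Re (a * f w).
Proof.
move=> Hu Hf Ow ucv.
have Hk := hsZ hs (a^*) (kernel_at_H Ow).
have evE g : H g -> complex.Re (a * g w) = rdot dot g (a^* *: kernel_at w).
  move=> Hg; rewrite /rdot (dotZr hs)//; last exact: kernel_at_H.
  by rewrite conjCK dot_kernel_at.
rewrite evE// (_ : (fun k => _) = fun k => rdot dot (u k) (a^* *: kernel_at w)).
  exact: (rdot_cvg hs).
by apply/funext => k; rewrite evE.
Qed.

(** Translation is isometric on the span, so it maps an approximating sequence of f
to a Cauchy sequence; the limit of the latter in H agrees pointwise with the
translate of f. *)
Lemma translate_limit s f : s \in G -> H f ->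
  H (translate s f) /\ hnorm dot (translate s f) = hnorm dot f.
Proof.
move=> Gs Hf.
have inv0 k : 0 < k.+1%:R^-1 :> R by rewrite invr_gt0.
have /choice[u uP] : forall k : nat, exists u, kernel_span u /\
    hnorm dot (f - u) < k.+1%:R^-1.
  by move=> k; have [u Su ul] := kernel_span_dense Hf (inv0 k); exists u.
have Su k : kernel_span (u k) by case: (uP k).
have Hu k := kernel_span_H (Su k).
have Ssu k : kernel_span (translate s (u k)) by exact: translate_span.
have Hsu k := kernel_span_H (Ssu k).
have ucv : hnorm dot (u k - f) @[k --> \oo] --> (0 : R).
  apply/hnorm_cvg0P => e e0; exists (Num.truncn e^-1) => k kN.
  rewrite (hnorm_sub hs)//; case: (uP k) => _ /lt_trans; apply.
  rewrite invf_plt ?posrE//; apply: lt_le_trans (truncnS_gt _) _.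
  by rewrite ler_nat ltnS.
have [|g Hg gcv] := hs_complete hs Hsu.
  move=> e e0; move/hnorm_cvg0P: ucv => /(_ (e / 2)).
  rewrite divr_gt0// => /(_ isT)[N NP]; exists N => j k jN kN.
  rewrite -translateB hnorm_translate_span//; last exact: kernel_spanB.
  have -> : u j - u k = (u j - f) + (f - u k) by rewrite addrA subrK.
  apply: le_lt_trans (hnorm_triangle hs (hsB hs (Hu j) Hf) (hsB hs Hf (Hu k))) _.
  by rewrite (hnorm_sub hs Hf (Hu k)) (splitr e) ltrD ?NP.
have gE : translate s f = g.
  apply/funext => z; have [Oz|nOz] := pselect (Omega z); last first.
    have [_ ->//] := HO Hg; rewrite /translate/=.
    by have [_ ->//] := HO Hf; rewrite invariant_setE.
  have Osz := invariant_set_mem Gs Oz.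
  have evE a : complex.Re (a * f (rG s *m z)) = complex.Re (a * g z).
    have := @eval_cvg a _ _ _ Hsu Hg Oz gcv; apply: cvg_unique => //.
    exact: (@eval_cvg a _ _ _ Hu Hf Osz ucv).
  rewrite /translate/=; apply: Cplx_ext.
    by have := evE 1; rewrite !mul1r.
  have := evE (- 'i%C : C); case: (f _) (g z) => [a b] [c d] /=.
  by rewrite !oppr0 !mul0r !sub0r !mulN1r !opprK.
rewrite gE; split => //.
have := hnorm_cvg hs Hsu Hg gcv.
under eq_fun do rewrite hnorm_translate_span//.
by move=> /cvg_unique; apply => //; exact: (hnorm_cvg hs).
Qed.

Lemma translate_H s f : s \in G -> H f -> H (translate s f).
Proof. by move=> Gs Hf; case: (translate_limit Gs Hf). Qed.

Lemma rdot_translate s f g : s \in G -> H f -> H g ->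
  rdot dot (translate s f) (translate s g) = rdot dot f g.
Proof.
move=> Gs Hf Hg.
have sq h : H h -> rdot dot (translate s h) (translate s h) = rdot dot h h.
  move=> Hh; have [Hsh hE] := translate_limit Gs Hh.
  by rewrite -!(hnorm_sqr hs)// hE.
have Hsf := translate_H Gs Hf; have Hsg := translate_H Gs Hg.
have := sq _ (hsD hs Hf Hg); rewrite translateD.
have := @rdot_lin _ _ _ _ hs _ _ 1 Hf Hg; rewrite scale1r => ->.
have := @rdot_lin _ _ _ _ hs _ _ 1 Hsf Hsg; rewrite scale1r => ->.
rewrite !sq//; lra.
Qed.

(** Polarisation has recovered the real form from the norm; the imaginary part
follows by linearity. *)
Lemma dot_translate s f g : s \in G -> H f -> H g ->
  dot (translate s f) (translate s g) = dot f g.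
Proof.
move=> Gs Hf Hg; have Hsf := translate_H Gs Hf; have Hsg := translate_H Gs Hg.
apply: Cplx_ext; first exact: rdot_translate.
rewrite !(Im_dot hs)// -(rdot_translate Gs (hsZ hs _ Hf) Hg).
by congr rdot; rewrite -[_ *: f]addr0 translate_lin addr0.
Qed.

End InvariantKernel.

(** * Ranges of self-adjoint idempotents *)

Section Reducing.
Variables (R : realType) (n : nat) (H : set (Fn R n)).
Variable dot : Fn R n -> Fn R n -> Cplx R.
Hypothesis hs : hilbert_space H dot.

(** The range is the set of f with P f = f.  It is closed because P f = f says that
f is orthogonal to the functions h - P h.  If g is the adjoint of T at some f in
the range, then P g satisfies the equation that characterises g, hence P g = g;
if there is no adjoint at f the chosen value is 0. *)
Lemma projection_joint_reducing (P : Fn R n -> Fn R n)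
    (ops : set (Fn R n -> Fn R n)) :
  (forall f, H f -> H (P f)) ->
  (forall (a : Cplx R) f g, P (a *: f + g) = a *: P f + P g) ->
  (forall f, P (P f) = P f) ->
  (forall f g, H f -> H g -> dot (P f) g = dot f (P g)) ->
  (forall T, ops T -> forall f, H f -> H (T f) /\ P (T f) = T (P f)) ->
  joint_reducing H dot ops (P @` H).
Proof.
move=> PH Plin Pidem Psym opsP.
have ME f : (P @` H) f <-> H f /\ P f = f.
  by split=> [[g Hg <-]|[Hf <-]]; [split; [exact: PH|exact: Pidem]|exists f].
have P0 : P 0 = 0 by have := Plin (-1) 0 0; rewrite scaleN1r addNr scaleN1r addNr.
have M0 : (P @` H) 0 by apply/ME; split => //; exact: (hs0 hs).
split; [split|].
- by move=> f /ME[].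
- split; first by rewrite inE.
  move=> a f g /[!inE] /ME[Hf Pf] /ME[Hg Pg]; apply/ME.
  by split; [exact: (hsDZ hs)|rewrite Plin Pf Pg].
- move=> u f Mu Hf ucv; apply/ME; split=> //.
  have Hu k : H (u k) by have /ME[] := Mu k.
  have Pu k : P (u k) = u k by have /ME[] := Mu k.
  have HPf := PH _ Hf; have Hd := hsB hs Hf HPf.
  have HPd := PH _ Hd; have Hdd := hsB hs Hd HPd.
  have Pd : P (f - P f) = 0.
    by rewrite addrC -scaleN1r Plin Pidem scaleN1r addNr.
  apply/esym/eqP; rewrite -subr_eq0; apply/eqP; apply: (rdot_eq0 hs) => //.
  rewrite {1}/rdot (dotBl hs)// Psym// Pd.
  rewrite (hs_conj hs (hs0 hs) Hf) (dot0l hs)// rmorph0 subr0.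
  have := rdot_cvg hs Hu Hf Hd ucv.
  under eq_fun => k.
    rewrite /rdot -Pu Psym// Pd (hs_conj hs (hs0 hs) (Hu k)) (dot0l hs)// rmorph0.
    over.
  by move=> /cvg_unique; apply => //; exact: cvg_cst.
move=> T oT f /ME[Hf Pf]; split.
  have [HTf PT] := opsP _ oT _ Hf.
  by apply/ME; split => //; rewrite PT Pf.
rewrite /adjoint; case: xgetP => [g _ [Hg gP]|_]//.
apply/ME; split=> //; have HPg := PH _ Hg; have Hd := hsB hs HPg Hg.
apply/eqP; rewrite -subr_eq0; apply/eqP; apply: (dot_eq0 hs) => //.
have key h : H h -> dot h (P g) = dot h g.
  move=> Hh; rewrite -Psym// -gP//; last exact: PH.
  have [HT PT] := opsP _ oT _ Hh.
  by rewrite -PT Psym// Pf gP.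
by rewrite (dotBr hs)// key// subrr.
Qed.

End Reducing.

(** * The operators P_rho^ii *)

Section IsotypicProjection.
Variables (R : realType) (n : nat) (gT : finGroupType) (G : {group gT}).
Variable rG : mx_representation (Cplx R) G n.
Local Notation C := (Cplx R).

Lemma PopE d (r : mx_representation C G d) i j f z :
  Pop rG r i j f z =
  d%:R / #|G|%:R * \sum_(s in G) r (s^-1)%g j i * f (rG (s^-1)%g *m z).
Proof.
by rewrite /Pop fctE /= fct_sumE.
Qed.

Lemma Pop_lin d (r : mx_representation C G d) i j (a : C) f g :
  Pop rG r i j (a *: f + g) = a *: Pop rG r i j f + Pop rG r i j g.
Proof.
apply/funext => z.
transitivity (a * Pop rG r i j f z + Pop rG r i j g z); last by [].
rewrite !PopE [in RHS]mulrCA -mulrDr; congr (_ * _).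
rewrite mulr_sumr -big_split; apply: eq_bigr => s _ /=.
by rewrite mulrDr mulrCA.
Qed.

Lemma Pop_mulop d (r : mx_representation C G d) i j p f :
  invariant_poly rG p -> Pop rG r i j (mulop p f) = mulop p (Pop rG r i j f).
Proof.
move=> pinv; apply/funext => z; rewrite /mulop !PopE mulrCA; congr (_ * _).
rewrite mulr_sumr; apply: eq_bigr => s Gs.
by rewrite pinv ?groupV// mulrCA.
Qed.

(** The composite is a double sum over s and t of translates by the inverse of
u = s t; expanding r2 (u^-1 s) isolates the sums evaluated by Schur
orthogonality. *)
Lemma Pop_Pop d1 d2 (r1 : mx_representation C G d1)
    (r2 : mx_representation C G d2) i j f z :
  Pop rG r1 i i (Pop rG r2 j j f) z =
  d1%:R / #|G|%:R * (d2%:R / #|G|%:R) * \sum_(u in G)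
    (\sum_k r2 (u^-1)%g j k * \sum_(s in G) r1 (s^-1)%g i i * r2 s k j) *
    f (rG (u^-1)%g *m z).
Proof.
rewrite PopE -[RHS]mulrA; congr (_ * _).
under eq_bigr do rewrite PopE mulrCA.
rewrite -mulr_sumr; congr (_ * _).
transitivity (\sum_(s in G) \sum_(u in G)
    r1 (s^-1)%g i i * r2 (u^-1 * s)%g j j * f (rG (u^-1)%g *m z)).
  apply: eq_bigr => s Gs; rewrite mulr_sumr.
  rewrite [RHS](reindex_inj (mulgI s)) /=.
  apply: eq_big => [t|t Gt]; first by rewrite groupMl.
  by rewrite invMg mulgKV mulrA mulmxA -repr_mxM ?groupV.
rewrite exchange_big; apply: eq_bigr => u Gu; rewrite -mulr_suml; congr (_ * _).
under eq_bigr => s Gs.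
  rewrite repr_mxM ?groupV// mxE mulr_sumr.
  under eq_bigr do rewrite mulrCA.
  over.
by rewrite exchange_big; apply: eq_bigr => k _; rewrite mulr_sumr.
Qed.

Lemma Pop_orth_neq d1 d2 (r1 : mx_representation C G d1)
    (r2 : mx_representation C G d2) i j f :
  mx_irreducible r1 -> mx_irreducible r2 -> ~ mx_rsim r1 r2 ->
  Pop rG r1 i i (Pop rG r2 j j f) = 0.
Proof.
move=> irr1 irr2 nsim; apply/funext => z; rewrite Pop_Pop big1 ?mulr0// => u _.
rewrite big1 ?mul0r// => k _.
by rewrite (schur_orthogonality_neq _ _ _ _ irr1 irr2 nsim) mulr0.
Qed.

Lemma Pop_orth_eq d (r : mx_representation C G d) i j f :
  mx_irreducible r ->
  Pop rG r i i (Pop rG r j j f) = (i == j)%:R *: Pop rG r i i f.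
Proof.
move=> irr; apply/funext => z; rewrite Pop_Pop.
transitivity ((i == j)%:R * Pop rG r i i f z); last by [].
rewrite PopE.
have d0 : d%:R != 0 :> C by rewrite pnatr_eq0 -lt0n; case/mx_irrP: irr.
have G0 : #|G|%:R != 0 :> C by rewrite pnatr_eq0 -lt0n cardG_gt0.
under eq_bigr => u Gu.
  rewrite (bigD1 i)//= schur_orthogonality_eq// eqxx andbT big1 ?addr0; last first.
    move=> k ki; rewrite schur_orthogonality_eq// [i == k]eq_sym (negPf ki).
    by rewrite andbF !mulr0.
  rewrite (_ : _ * _ = #|G|%:R / d%:R *
    ((i == j)%:R * (r (u^-1)%g i i * f (rG u^-1%g *m z)))); last first.
    by case: eqP => [->|_]; rewrite ?mulr0 ?mul0r ?mulr0//; ring.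
  over.
rewrite -!mulr_sumr; set S := (\sum_(_ in _) _).
by field; rewrite d0 G0.
Qed.

Lemma unitary_repr_inv d (r : mx_representation C G d) s i j : s \in G ->
  r s \is unitarymx -> r (s^-1)%g i j = (r s j i)^*.
Proof.
move=> Gs /unitarymxP rs.
have -> : r (s^-1)%g = r (s^-1)%g *m (r s *m (r s)^t*)%sesqui by rewrite rs mulmx1.
by rewrite mulmxA -repr_mxM ?groupV// mulVg repr_mx1 mul1mx !mxE.
Qed.

End IsotypicProjection.

(** * The ranges as distinct reducing submodules *)

Section RangeSubmodules.
Variables (R : realType) (n : nat) (gT : finGroupType) (G : {group gT}).
Variable rG : mx_representation (Cplx R) G n.
Variables (Omega : set (Cn R n)) (H : set (Fn R n)).
Variables (dot : Fn R n -> Fn R n -> Cplx R) (K : Cn R n -> Cn R n -> Cplx R).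
Hypotheses (hinv : invariant_set rG Omega) (hK : invariant_kernel rG Omega K).
Hypothesis hH : analytic_hilbert_module Omega H dot K.
Local Notation C := (Cplx R).
Let hs := ahm_hilbert hH.

Let trH s f : s \in G -> H f -> H (translate rG s f).
Proof.
exact: (translate_H hinv hK hs (ahm_holo hH) (ahm_kernel hH)).
Qed.

Let dot_tr s f g : s \in G -> H f -> H g ->
  dot (translate rG s f) (translate rG s g) = dot f g.
Proof.
exact: (dot_translate hinv hK hs (ahm_holo hH) (ahm_kernel hH)).
Qed.

Lemma Pop_H d (r : mx_representation C G d) i j f : H f -> H (Pop rG r i j f).
Proof.
move=> Hf; apply: (hsZ hs); apply: (hs_sum hs) => s Gs; apply: (hsZ hs).
by apply: trH; rewrite ?groupV.
Qed.

Lemma dot_translateV s f g : s \in G -> H f -> H g ->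
  dot (translate rG s f) g = dot f (translate rG (s^-1)%g g).
Proof.
move=> Gs Hf Hg; rewrite -(dot_tr Gs Hf); last by apply: trH; rewrite ?groupV.
congr dot; apply/funext => z; rewrite /translate/=.
by rewrite repr_mulKV.
Qed.

(** Passing to the adjoint exchanges s and its inverse, both in the translation and,
by unitarity, in the matrix coefficient. *)
Lemma Pop_selfadjoint d (r : mx_representation C G d) i f g :
  (forall s, s \in G -> r s \is unitarymx) -> H f -> H g ->
  dot (Pop rG r i i f) g = dot f (Pop rG r i i g).
Proof.
move=> ru Hf Hg.
have Htr h s : H h -> s \in G ->
    H (r (s^-1)%g i i *: translate rG (s^-1)%g h).
  by move=> Hh Gs; apply: (hsZ hs); apply: trH; rewrite ?groupV.
rewrite /Pop (dotZl hs)//; last by apply: (hs_sum hs) => s; exact: Htr.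
rewrite (dotZr hs)//; last by apply: (hs_sum hs) => s; exact: Htr.
congr (_ * _); first by rewrite rmorphM fmorphV !rmorph_nat.
rewrite (dot_suml hs)//; last by move=> s; exact: Htr.
rewrite (dot_sumr hs)//; last by move=> s; exact: Htr.
rewrite (reindex_inj invg_inj) /=.
apply: eq_big => [s|s Gs]; first by rewrite groupV.
rewrite groupV in Gs; rewrite invgK (dotZl hs)//; last exact: trH.
rewrite (dotZr hs)//; last by apply: trH; rewrite ?groupV.
by rewrite dot_translateV// (unitary_repr_inv _ _ Gs (ru _ Gs)) conjCK.
Qed.

Lemma Pop_joint_reducing d (r : mx_representation C G d) i :
  mx_irreducible r -> (forall s, s \in G -> r s \is unitarymx) ->
  reducing_submodule rG H dot (Pop rG r i i @` H).
Proof.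
move=> irr ru; apply: (projection_joint_reducing hs).
- by move=> f; exact: Pop_H.
- by move=> a f g; exact: Pop_lin.
- by move=> f; rewrite Pop_orth_eq// eqxx scale1r.
- by move=> f g; exact: Pop_selfadjoint.
- move=> _ [p pinv <-] f Hf; split; first exact: (ahm_mul hH).
  exact: Pop_mulop.
Qed.

(** At a point z with free orbit, only the term of the identity survives for a
polynomial that is nonzero at z and zero at the other points of the orbit. *)
Lemma Pop_neq0 d (r : mx_representation C G d) i :
  mx_faithful rG -> open Omega -> Omega !=set0 -> (0 < d)%N ->
  exists2 f, H f & Pop rG r i i f != 0.
Proof.
move=> fG oO O0 d0.
have [z Oz zfree] := free_orbit_point fG oO O0.
have [|p pz p0] := @separating_poly R n gT (fun s => (s \in G) && (s != 1%g)) z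
    (fun s => rG s *m z).
  by move=> s /andP[]; exact: zfree.
exists (ext0 Omega (peval p)); first exact: (ahm_poly hH).
apply/eqP => /(congr1 (fun f => f z)); rewrite PopE.
rewrite (bigD1 1%g)//= big1 ?addr0 => [|s /andP[Gs s1]]; last first.
  rewrite ext0_in; last by apply: (invariant_set_mem hinv); rewrite ?groupV.
  by rewrite p0 ?mulr0// groupV Gs invg_eq1.
rewrite invg1 !repr_mx1 mul1mx ext0_in// mxE eqxx mul1r => /eqP.
rewrite !mulf_eq0 (negPf pz) orbF invr_eq0 !pnatr_eq0.
by rewrite eqn0Ngt d0 eqn0Ngt cardG_gt0.
Qed.

End RangeSubmodules.

(** theta_k is the k-th variable evaluated at theta, so that it belongs to the
algebra generated by theta. *)
Lemma hsop_invariant (R : realType) (n : nat) (gT : finGroupType)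
    (G : {group gT}) (rG : mx_representation (Cplx R) G n)
    (theta : n.-tuple (mpoly n (Cplx R))) k :
  hsop rG theta -> invariant_poly rG (tnth theta k).
Proof.
move=> ht; rewrite (hsop_generate ht); exists (mpolyX _ (mnm1 k)) => //.
by rewrite comp_mpolyXU -tnth_nth.
Qed.

Lemma card_le_sum_ord (I : finType) (deg : I -> nat) (T : Type) (A : set T)
    (F : forall r : I, 'I_(deg r) -> T) :
  (forall r i, A (F r i)) ->
  (forall r1 (i1 : 'I_(deg r1)) r2 (i2 : 'I_(deg r2)), F r1 i1 = F r2 i2 ->
     Tagged (fun r => 'I_(deg r)) i1 = Tagged (fun r => 'I_(deg r)) i2) ->
  [set: 'I_(\sum_(r : I) deg r)%N] #<= A.
Proof.
move=> FA Finj.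
have cardE : (\sum_(r : I) deg r)%N = #|{: {r : I & 'I_(deg r)}}|.
  rewrite card_tagged sumnE big_map big_enum.
  by apply: eq_bigr => r _; rewrite card_ord.
pose g (k : 'I_(\sum_(r : I) deg r)%N) : {r : I & 'I_(deg r)} :=
  enum_val (cast_ord cardE k).
have ginj : injective g by move=> j k /enum_val_inj/cast_ord_inj.
pose h k := F (tag (g k)) (tagged (g k)).
have hinj : injective h.
  move=> j k /Finj jk; apply: ginj.
  by move: jk; case: (g j) (g k) => [a b] [c d].
have := @card_ge_preimage _ _ A h (in2W hinj).
rewrite (_ : h @^-1` A = [set: 'I_(\sum_(r : I) deg r)%N])//.
by apply/seteqP; split=> // k _; exact: FA.
Qed.

Theorem theorem5p7 (R : realType) (n : nat)
    (gT : finGroupType) (G : {group gT})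
    (rG : mx_representation (Cplx R) G n)
    (hG : pseudoreflection_group rG)
    (Omega : set (Cn R n))
    (hOmega : is_domain Omega) (hbounded : bounded_set Omega)
    (hinv : invariant_set rG Omega)
    (theta : n.-tuple (mpoly n (Cplx R))) (htheta : hsop rG theta)
    (H : set (Fn R n)) (dot : Fn R n -> Fn R n -> Cplx R)
    (K : Cn R n -> Cn R n -> Cplx R)
    (hH : analytic_hilbert_module Omega H dot K)
    (hK : invariant_kernel rG Omega K)
    (I : finType) (deg : I -> nat)
    (pi : forall r : I, mx_representation (Cplx R) G (deg r))
    (hpi : unitary_dual pi) :
  (forall (r : I) (i : 'I_(deg r)),
      reducing_submodule rG H dot (Pop rG (pi r) i i @` H) /\
      joint_reducing H dot
        [set mulop (tnth theta k) | k in [set: 'I_n]]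
        (Pop rG (pi r) i i @` H)) /\
  [set: 'I_(\sum_(r : I) deg r)%N] #<= [set M | reducing_submodule rG H dot M].
Proof.
have hs := ahm_hilbert hH.
have [fG _] := hG; have [neO oO _] := hOmega.
have irr := ud_irr hpi.
have red r i : reducing_submodule rG H dot (Pop rG (pi r) i i @` H).
  apply: (Pop_joint_reducing hinv hK hH) => //.
  by move=> s; exact: (ud_unitary hpi).
split=> [r i|].
  split=> //; have [cl inv] := red r i; split=> // _ [k _ <-].
  by apply: inv; exists (tnth theta k) => //; exact: hsop_invariant.
apply: (card_le_sum_ord (F := fun r i => Pop rG (pi r) i i @` H)) => //.
move=> r1 i1 r2 i2 M12.
have d0 : (0 < deg r1)%N by case/mx_irrP: (irr r1).
have [f Hf /eqP Pf0] := Pop_neq0 hinv hH (pi r1) i1 fG oO neO d0.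
have [g Hg gE] : (Pop rG (pi r2) i2 i2 @` H) (Pop rG (pi r1) i1 i1 f).
  by rewrite -M12; exists f.
(* A function in both ranges is fixed by both operators, whose product is 0
unless the indices agree. *)
have Pf : Pop rG (pi r1) i1 i1 f =
    Pop rG (pi r1) i1 i1 (Pop rG (pi r2) i2 i2 g).
  by rewrite gE Pop_orth_eq// eqxx scale1r.
have [r12|nr12] := pselect (r1 = r2); last first.
  case: Pf0; rewrite Pf Pop_orth_neq//.
  by move=> /(ud_inj hpi).
subst r2; have [->//|ni] := eqVneq i1 i2.
by case: Pf0; rewrite Pf Pop_orth_eq// (negPf ni) scale0r.
Qed.
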